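(* Let $\delta>0$. For every function $y_0:(-3\delta,-\delta]\to\mathbb{R}$ there is a unique function $y:(-\infty,0]\to\mathbb{R}$ such that $y(3x)=y(x)+y(2x)$ for all $x\in(-\infty,0]$ and $y(x)=y_0(x)$ for all $x\in(-3\delta,-\delta]$.
   Context: No continuity is assumed. *)

(* Defs.v *)
From HB Require Import structures.
From mathcomp Require Import all_boot all_order all_algebra.
From mathcomp Require Import reals.
Set Implicit Arguments.
Unset Strict Implicit.
Unset Printing Implicit Defensive.
Import Order.TTheory GRing.Theory Num.Theory.
Local Open Scope ring_scope.

(* The domains are subtypes cut out by boolean interval membership, so that
   functions on them carry no junk values and [exists!] is uniqueness of the
   function itself. *)
Definition nonposR (R : realType) := {x : R | x \in `]-oo, 0]}.

Definition initR (R : realType) (delta : R) :=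
  {x : R | x \in `](- (3 * delta)), (- delta)]}.

Lemma mulrn_nonposR (R : realType) (n : nat) (x : nonposR R) :
  n%:R * val x \in `]-oo, 0 : R].
Proof.
by case: x => x /=; rewrite !in_itv /= => x_le0; rewrite mulr_ge0_le0 ?ler0n.
Qed.

Definition scale_nonposR (R : realType) (n : nat) (x : nonposR R) : nonposR R :=
  exist _ (n%:R * val x) (mulrn_nonposR n x).

Lemma initR_nonposR (R : realType) (delta : R) (delta_gt0 : 0 < delta)
  (x : initR delta) : val x \in `]-oo, 0 : R].
Proof.
case: x => x /=; rewrite !in_itv /= => /andP[_ x_le].
by rewrite (le_trans x_le) // oppr_le0 ltW.
Qed.

Definition incl_initR (R : realType) (delta : R) (delta_gt0 : 0 < delta)
  (x : initR delta) : nonposR R :=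
  exist _ (val x) (initR_nonposR delta_gt0 x).

(* Main.v *)
Require Import Defs.
From HB Require Import structures.
From mathcomp Require Import all_boot all_order all_algebra.
From mathcomp Require Import boolp reals.
From mathcomp Require Import ring lra.
Set Implicit Arguments.
Unset Strict Implicit.
Unset Printing Implicit Defensive.
Import Order.TTheory GRing.Theory Num.Theory.
Local Open Scope ring_scope.

(* The functional equation, read at [x / 3] when [x <= - 3 * delta] and at [x]
   when [- delta < x < 0], expresses [y x] through values of [y] at points
   geometrically closer to the initial interval; at [0] it forces [y 0 = 0].
   So the equation together with the initial condition is a fixed point
   equation [y = F y] in which [F] is a recursion along a rank, namely the
   number of dilations of the initial interval by [3 / 2] on both sides needed
   to reach [x]; such a recursion has exactly one solution. *)

Section RankRecursion.
Variables (T A : Type) (rank : T -> nat) (F : (T -> A) -> T -> A).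
Hypothesis F_local : forall f g x,
  (forall z, (rank z < rank x)%N -> f z = g z) -> F f x = F g x.

Lemma rank_fixpoint_unique f g :
  (forall x, f x = F f x) -> (forall x, g x = F g x) -> forall x, f x = g x.
Proof.
move=> fE gE x; have [n] := ubnP (rank x); elim: n x => // n IHn x.
rewrite ltnS => le_xn; rewrite fE gE; apply: F_local => z lt_zx.
exact/IHn/(leq_trans lt_zx).
Qed.

(** The iterates of [F] from [f0] no longer change at [x] once their number exceeds [rank x]; the
    fixed point takes this stable value. *)
Lemma rank_fixpoint_exists (f0 : T -> A) : exists f, forall x, f x = F f x.
Proof.
have stable m n x : (rank x < m)%N -> (rank x < n)%N ->
    iter m F f0 x = iter n F f0 x.
  elim: m n x => // m IHm [//|n] x; rewrite !ltnS => le_xm le_xn.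
  by apply: F_local => z lt_zx; apply: IHm; apply: leq_trans lt_zx _.
exists (fun x => iter (rank x).+1 F f0 x) => x.
by apply: F_local => z lt_zx; apply: stable.
Qed.

End RankRecursion.

Section Equation.
Variables (R : realType) (delta : R) (delta_gt0 : 0 < delta).
Implicit Types (x z : nonposR R) (y : nonposR R -> R).

Lemma nonposR_le0 x : val x <= 0.
Proof. by case: x => x /=; rewrite in_itv. Qed.

Lemma third_nonposR_subproof x : val x / 3 \in `]-oo, 0 : R].
Proof. by rewrite in_itv; have := nonposR_le0 x => /=; lra. Qed.

Definition third_nonposR x : nonposR R :=
  exist _ (val x / 3) (third_nonposR_subproof x).

Lemma val_third_nonposR x : val (third_nonposR x) = val x / 3.
Proof. by []. Qed.

Lemma val_scale_nonposR n x : val (scale_nonposR n x) = n%:R * val x.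
Proof. by []. Qed.

Lemma scale3_third x : scale_nonposR 3 (third_nonposR x) = x.
Proof. by apply: val_inj => /=; field. Qed.

Lemma third_scale3 x : third_nonposR (scale_nonposR 3 x) = x.
Proof. by apply: val_inj => /=; field. Qed.

Lemma scale_nonposR0 n x : val x = 0 -> scale_nonposR n x = x.
Proof. by move=> x0; apply: val_inj; rewrite /= x0 mulr0. Qed.

(** Membership in [(-3 delta (3/2)^n, -delta (2/3)^n]], with the upper bound cleared of its
    denominator. The point 0 lies in no such interval and is adjoined at every [n], so it has rank
    0. *)
Definition within n x :=
  (- (3 * delta) * (3 / 2) ^+ n < val x) &&
  ((val x == 0) || (val x * (3 / 2) ^+ n <= - delta)).

(** Bernoulli's inequality; linear growth is what the Archimedean property can exploit. *)
Lemma expr32_ge n : n%:R / 2 + 1 <= (3 / 2) ^+ n :> R.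
Proof.
elim: n => [|n IHn]; first by rewrite expr0; lra.
have : 0 <= n%:R :> R by [].
rewrite exprS -natr1; lra.
Qed.

Lemma expr32_ge1 n : 1 <= (3 / 2) ^+ n :> R.
Proof. by apply: exprn_ege1; lra. Qed.

Lemma within_exists x : exists n, within n x.
Proof.
(* Both summands are nonnegative: the first controls the outer bound, the second the inner one.
   Taking [n] above [2 * b] compensates the slope 1/2 in [expr32_ge]. *)
pose b := - val x / delta - (if val x == 0 then 0 else delta / val x).
exists (Num.bound `|2 * b|).
have := archi_boundP (normr_ge0 (2 * b)); set n := Num.bound _.
have := expr32_ge n; rewrite /within.
move: (_ ^+ n) n%:R => c m le_mc /(le_lt_trans (ler_norm _)) lt_bm.
have {m le_mc lt_bm} : b + 1 < c by lra.
rewrite /b {n b}; move: (val x) (nonposR_le0 x) => v v_le0.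
have q_ge0 : 0 <= - v / delta by rewrite divr_ge0 ?oppr_ge0 // ltW.
have qE : - v = - v / delta * delta by rewrite divfK // gt_eqF.
case: eqVneq => [->|v_neq0] /=.
  rewrite andbT oppr0 mul0r !add0r => c_gt1.
  by rewrite mulNr oppr_lt0 !mulr_gt0 // (lt_trans ltr01).
have v_lt0 : v < 0 by rewrite lt_neqAle v_neq0.
have r_lt0 : delta / v < 0 by rewrite pmulr_rlt0 // invr_lt0.
have rE : delta = delta / v * v by rewrite divfK.
move: (- v / delta) (delta / v) q_ge0 qE r_lt0 rE => q r q_ge0 qE r_lt0 rE c_gt.
by apply/andP; split; nra.
Qed.

Definition rank x := ex_minn (within_exists x).

Lemma within_rank x : within (rank x) x.
Proof. by rewrite /rank; case: ex_minnP. Qed.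

Lemma rank_le n x : within n x -> (rank x <= n)%N.
Proof. by rewrite /rank; case: ex_minnP => m _ min /min. Qed.

Variable y0 : initR delta -> R.

(** [insub] succeeds exactly on the initial interval, so the last branch is left with
    [- delta < val x < 0]. *)
Definition step y x : R :=
  if insub (val x) is Some u then y0 u
  else if val x == 0 then 0
  else if val x <= - (3 * delta) then
    y (third_nonposR x) + y (scale_nonposR 2 (third_nonposR x))
  else y (scale_nonposR 3 x) - y (scale_nonposR 2 x).

Lemma step_init y (u : initR delta) : step y (incl_initR delta_gt0 u) = y0 u.
Proof. by rewrite /step /= valK. Qed.

Lemma step_zero y x : val x = 0 -> step y x = 0.
Proof.
rewrite /step => ->; rewrite eqxx insubF //.
by rewrite in_itv /= oppr_ge0 leNgt delta_gt0 andbF.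
Qed.

Lemma step_far y x : val x <= - (3 * delta) ->
  step y x = y (third_nonposR x) + y (scale_nonposR 2 (third_nonposR x)).
Proof.
move=> x_far; rewrite /step insubF ?x_far; last first.
  by rewrite in_itv /= ltNge x_far.
by rewrite lt_eqF //; have := delta_gt0; lra.
Qed.

Lemma step_near y x : - delta < val x < 0 ->
  step y x = y (scale_nonposR 3 x) - y (scale_nonposR 2 x).
Proof.
move=> /andP[x_near x_lt0]; rewrite /step insubF; last first.
  by rewrite in_itv /= (leNgt (val x)) x_near andbF.
by rewrite lt_eqF // leNgt ifF //; apply/negbF; lra.
Qed.

Variant region_spec x : Prop :=
| RegionInit u of x = incl_initR delta_gt0 u
| RegionZero of val x = 0
| RegionFar of val x <= - (3 * delta)
| RegionNear of - delta < val x < 0.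

Lemma regionP x : region_spec x.
Proof.
have [x_near|x_le] := ltP (- delta) (val x).
  have [x0|x_neq0] := eqVneq (val x) 0; first exact: RegionZero.
  by apply: RegionNear; rewrite x_near lt_neqAle x_neq0 nonposR_le0.
have [x_far|x_gt] := leP (val x) (- (3 * delta)); first exact: RegionFar.
have xP : val x \in `](- (3 * delta)), (- delta)] by rewrite in_itv /= x_gt.
by apply: (@RegionInit _ (exist _ (val x) xP : initR delta)); apply: val_inj.
Qed.

(** In the far region [x/3] and [2x/3] are nearer by a factor at least 3/2, yet still at most
    [- delta]. In the near region [2x] and [3x] gain a factor at least 2, yet stay above
    [- 3 delta]. Neither overshoots the initial interval, so the rank drops. *)
Lemma step_local y y' x :
  (forall z, (rank z < rank x)%N -> y z = y' z) -> step y x = step y' x.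
Proof.
have := within_rank x; case: (regionP x) => [u ->|x0|x_far|x_near].
- by rewrite !step_init.
- by rewrite !step_zero.
- case: (rank x) => [|n]; rewrite /within.
    by rewrite expr0 mulr1 ltNge x_far.
  rewrite exprS => /andP[x_gt _] eq_yy'; rewrite !step_far //.
  have c_ge1 := expr32_ge1 n.
  (* [dc] and [xc] supply the products with the power, after which the bounds are linear in these
     products. *)
  have dc : delta <= delta * (3 / 2) ^+ n by rewrite ler_peMr // ltW.
  have xc : val x * (3 / 2) ^+ n <= - (3 * delta) * (3 / 2) ^+ n.
    by rewrite ler_wpM2r // (le_trans ler01).
  congr (_ + _); apply/eq_yy'; rewrite ltnS; apply: rank_le; rewrite /within;
    rewrite !(val_scale_nonposR, val_third_nonposR);
    move: (val x) (_ ^+ n) delta_gt0 x_gt xc dc => v c d_gt0 x_gt xc dc;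
    by apply/andP; split; [|apply/orP; right]; lra.
- have /andP[x_gt x_lt0] := x_near.
  case: (rank x) => [|n]; rewrite /within (lt_eqF x_lt0) orFb.
    by rewrite expr0 (mulr1 (val x)) (leNgt (val x)) x_gt andbF.
  rewrite exprS => /andP[_ x_le] eq_yy'; rewrite !step_near //.
  have c_ge1 := expr32_ge1 n.
  have dc : delta <= delta * (3 / 2) ^+ n by rewrite ler_peMr // ltW.
  have xc : val x * (3 / 2) ^+ n <= 0.
    by rewrite mulr_le0_ge0 ?(le_trans ler01) // ltW.
  congr (_ - _); apply/eq_yy'; rewrite ltnS; apply: rank_le; rewrite /within;
    rewrite !val_scale_nonposR;
    move: (val x) (_ ^+ n) delta_gt0 x_gt x_lt0 x_le xc dc
      => v c d_gt0 x_gt x_lt0 x_le xc dc;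
    by apply/andP; split; [|apply/orP; right]; lra.
Qed.

Lemma step_fixpointP y :
  (forall x, y (scale_nonposR 3 x) = y x + y (scale_nonposR 2 x)) /\
  (forall u, y (incl_initR delta_gt0 u) = y0 u) <->
  (forall x, y x = step y x).
Proof.
split=> [[yE y_init] x | yE].
  case: (regionP x) => [u ->|x0|x_far|x_near].
  - by rewrite step_init y_init.
  (* At 0 the equation reads [y 0 = y 0 + y 0]. *)
  - by rewrite step_zero //; have := yE x; rewrite !scale_nonposR0 //; lra.
  - by rewrite step_far // -yE scale3_third.
  - by rewrite step_near // yE addrK.
split=> [x | u]; last by rewrite yE step_init.
(* If [x <= - delta], then [3x] is in the far region and [step] is unfolded there; if
   [- delta < x < 0], it is unfolded at [x] itself. *)
have [x_le|x_gt] := leP (val x) (- delta).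
  by rewrite yE step_far ?third_scale3 // val_scale_nonposR; lra.
have [x0|x_neq0] := eqVneq (val x) 0.
  by rewrite !scale_nonposR0 // yE step_zero ?addr0.
rewrite [y x]yE step_near ?subrK //.
by rewrite x_gt lt_neqAle x_neq0 nonposR_le0.
Qed.

End Equation.

Theorem theorem5p4 (R : realType) (delta : R) (delta_gt0 : 0 < delta)
    (y0 : initR delta -> R) :
  exists! y : nonposR R -> R,
    (forall x : nonposR R,
        y (scale_nonposR 3 x) = y x + y (scale_nonposR 2 x)) /\
    (forall x : initR delta, y (incl_initR delta_gt0 x) = y0 x).
Proof.
have local := @step_local R delta delta_gt0 y0.
have [y yE] := rank_fixpoint_exists local (fun=> 0).
exists y; split=> [|y' /step_fixpointP y'E]; first exact/step_fixpointP.
by apply/funext; apply: rank_fixpoint_unique local _ _ yE y'E.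
Qed.
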